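(* Let $p$ be a fixed prime. For every $0<\epsilon<\frac14$ there is a constant $C$ (depending on $\epsilon$ and the fixed prime $p$) such that for all integers $k\ge 1$, $$g_\epsilon(\Gamma_{k,2})\le C\sqrt{\log|\Gamma_{k,2}|},$$ where $\Gamma_{k,2}$ is the relatively free group on $k$ generators in the variety of $p$-groups of lower $p$-series of class $2$.
   Context: For a group $\Gamma$ let $\Gamma^p$ be the subgroup generated by $\{g^p: g\in\Gamma\}$. The lower $p$-series of $\Gamma$ is the descending series $\Gamma=\varphi_1(\Gamma)\ge\varphi_2(\Gamma)\ge\cdots$ defined by $\varphi_{i+1}(\Gamma)=\varphi_i(\Gamma)^p[\varphi_i(\Gamma),\Gamma]$ for $i\ge1$. Let $F_k$ be the free group on $k$ generators. Then $\Gamma_{k,n}=F_k/\varphi_{n+1}(F_k)$, a finite $p$-group called the relatively free group on $k$ generators in the variety of $p$-groups of lower $p$-series of class $n$; in particular $\Gamma_{k,2}=F_k/\varphi_3(F_k)$. For a finite group $G$ and a finite generating multiset $T$ of $G$, a number $\epsilon>0$ is an average Kazhdan constant of $G$ with respect to $T$ if $$\inf_{\rho\in G_0^*}\ \inf_{0\neq v\in\mathcal H_\rho}\ \frac{1}{|T|}\sum_{t\in T}\frac{\|\rho(t)v-v\|^2}{\|v\|^2}\ \ge\ \epsilon,$$ where $G_0^*$ denotes the space of unitary representations $(\rho,\mathcal H_\rho)$ of $G$ with no non-zero invariant vectors (sums over $T$ and $|T|$ count multiplicity). For $0<\epsilon<1$, $g_\epsilon(G)$ is the minimal integer $N$ such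 that there is a generating (multi)set $T$ of $G$ with $|T|\le N$ for which $G$ has average Kazhdan constant with respect to $T$ greater than or equal to $\epsilon$. *)

(* Defs.v *)
From HB Require Import structures.
From mathcomp Require Import all_boot all_order all_algebra all_fingroup.
From mathcomp Require Import generic_quotient sesquilinear complex.
From mathcomp Require Import all_classical all_reals all_analysis.

Set Implicit Arguments.
Unset Strict Implicit.
Unset Printing Implicit Defensive.

Import Order.TTheory GRing.Theory Num.Theory.
Import numFieldNormedType.Exports.

Local Open Scope classical_set_scope.
Local Open Scope quotient_scope.
Local Open Scope group_scope.

Section Subgroups.
Variable G : groupType.
Implicit Types (A H K : set G) (x y g : G).

Definition is_subgroup H : Prop :=
  H 1 /\ (forall x y, H x -> H y -> H (x * y^-1)).

Definition is_normal H : Prop :=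
  is_subgroup H /\ (forall x g, H x -> H (x ^ g)).

Definition gen A : set G := smallest is_subgroup A.

Definition powsg (p : nat) H : set G := gen [set h ^+ p | h in H].

(* Commutators are [~ x, y] = x^-1 * y^-1 * x * y. *)
Definition commsg H K : set G := gen [set [~ h, k] | h in H & k in K].

Definition mulset H K : set G := [set h * k | h in H & k in K].

Definition lps_step (p : nat) H : set G :=
  mulset (powsg p H) (commsg H [set: G]).

(* The series starts at index 1; index 0 also carries the whole group. *)
Fixpoint lps (p i : nat) : set G :=
  if i is j.+1 then (if j is 0%N then [set: G] else lps_step p (lps p j))
  else [set: G].

Lemma subgroup1 H : is_subgroup H -> H 1.
Proof. by case. Qed.

Lemma subgroupV H x : is_subgroup H -> H x -> H x^-1.
Proof. by case=> H1 HV Hx; rewrite -[x^-1]mul1g; apply: HV. Qed.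

Lemma subgroupM H x y : is_subgroup H -> H x -> H y -> H (x * y).
Proof.
by move=> sH Hx Hy; rewrite -[y]invgK; apply: sH.2 => //; apply: subgroupV.
Qed.

Lemma gen_subgroup A : is_subgroup (gen A).
Proof.
split=> [H [[]]|x y Ax Ay H [sH AH]] //.
by apply: sH.2; [apply: Ax | apply: Ay].
Qed.

Lemma sub_gen A : A `<=` gen A.
Proof. by move=> x Ax H [_]; apply. Qed.

Lemma gen_min A H : is_subgroup H -> A `<=` H -> gen A `<=` H.
Proof. by move=> sH AH x; apply. Qed.

Lemma gen_normal A : (forall x g, A x -> A (x ^ g)) -> is_normal (gen A).
Proof.
move=> nA; split=> [|x g]; first exact: gen_subgroup.
have sgA := gen_subgroup A.
apply: (@gen_min A [set x | gen A (x ^ g)]); last first.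
  by move=> y Ay; apply: sub_gen; apply: nA.
split=> [|y z /= Ay Az] /=; first by rewrite conj1g; apply: subgroup1.
by rewrite conjMg conjVg; apply: sgA.2.
Qed.

Lemma powsg_normal p H : is_normal H -> is_normal (powsg p H).
Proof.
move=> nH; apply: gen_normal => _ g [h Hh <-].
by exists (h ^ g); rewrite ?conjXg //; apply: nH.2.
Qed.

Lemma commsg_normal H K : is_normal H -> is_normal K -> is_normal (commsg H K).
Proof.
move=> nH nK; apply: gen_normal => _ g [h Hh [k Kk <-]].
by exists (h ^ g); [apply: nH.2 | exists (k ^ g); rewrite ?conjRg //; apply: nK.2].
Qed.

Lemma mulset_normal H K : is_normal H -> is_normal K -> is_normal (mulset H K).
Proof.
move=> [sH nH] [sK nK]; split; last first.
  move=> _ g [h Hh [k Kk <-]]; rewrite conjMg.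
  by exists (h ^ g); [exact: nH | exists (k ^ g); first exact: nK].
split; first by exists 1; [|exists 1; rewrite ?mulg1 //]; apply: subgroup1.
move=> _ _ [h Hh [k Kk <-]] [h' Hh' [k' Kk' <-]].
exists (h * h'^-1); first exact: sH.2.
exists ((k * k'^-1) ^ h'^-1); first by apply: nK; apply: sK.2.
by rewrite conjgE invgK invgM !mulgA mulgKV.
Qed.

Lemma setT_normal : is_normal [set: G].
Proof. by []. Qed.

Lemma lps_normal p i : is_normal (lps p i).
Proof.
elim: i => [|[|i] IHi] //=.
by apply: mulset_normal; [apply: powsg_normal | apply: commsg_normal].
Qed.

End Subgroups.

Arguments lps : clear implicits.

Record normalSubgroup (G : groupType) := NormalSubgroup {
  nsubset : set G;
  nsubsetP : is_normal nsubset
}.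

Section Quotient.
Variables (G : groupType) (N : normalSubgroup G).

Let sN : is_subgroup (nsubset N) := (nsubsetP N).1.
Let nN : forall x g, nsubset N x -> nsubset N (x ^ g) := (nsubsetP N).2.

Definition coset_rel (x y : G) : bool := `[< nsubset N (x^-1 * y) >].

Lemma coset_rel_refl : reflexive coset_rel.
Proof. by move=> x; apply/asboolP; rewrite mulVg; apply: subgroup1. Qed.

Lemma coset_rel_sym : symmetric coset_rel.
Proof.
by move=> x y; apply/idP/idP=> /asboolP h; apply/asboolP;
  rewrite -[_ * _]invgK invgM invgK; apply: subgroupV.
Qed.

Lemma coset_rel_trans : transitive coset_rel.
Proof.
move=> y x z /asboolP xy /asboolP yz; apply/asboolP.
by rewrite -[z](mulVKg y) mulgA; apply: subgroupM.
Qed.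

Canonical coset_equiv :=
  EquivRel coset_rel coset_rel_refl coset_rel_sym coset_rel_trans.

Definition quo : Type := {eq_quot coset_rel}.
HB.instance Definition _ := Choice.on quo.
HB.instance Definition _ := EqQuotient.on quo.

Definition quo_one : quo := \pi_quo 1.
Definition quo_mul (a b : quo) : quo := \pi_quo (repr a * repr b).
Definition quo_inv (a : quo) : quo := \pi_quo (repr a)^-1.

Lemma quo_eqP (x y : G) : \pi_quo x = \pi_quo y <-> nsubset N (x^-1 * y).
Proof.
by split=> [/eqmodP/asboolP | h] //; apply/eqmodP/asboolP.
Qed.

Lemma quo_repr (x : G) : nsubset N (x^-1 * repr (\pi_quo x)).
Proof. by apply/quo_eqP; rewrite reprK. Qed.

Lemma quo_mulE (x y : G) : quo_mul (\pi x) (\pi y) = \pi_quo (x * y).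
Proof.
apply/esym/quo_eqP; have := quo_repr x; have := quo_repr y.
set x' := repr _; set y' := repr _ => Ny Nx.
have -> : (x * y)^-1 * (y' * x') = (x^-1 * y') ^ y * (y^-1 * x').
  by rewrite conjgE invgM !mulgA mulgK.
by apply: subgroupM => //; apply: nN.
Qed.

Lemma quo_invE (x : G) : quo_inv (\pi x) = \pi_quo x^-1.
Proof.
apply/quo_eqP; rewrite invgK.
have := nN x^-1 (quo_repr x); rewrite conjgE invgK mulgA mulVKg.
by [].
Qed.

Lemma quo_mulA : associative quo_mul.
Proof.
by elim/quotW=> x; elim/quotW=> y; elim/quotW=> z; rewrite !quo_mulE mulgA.
Qed.
Lemma quo_mul1 : left_id quo_one quo_mul.
Proof. by elim/quotW=> x; rewrite /quo_one quo_mulE mul1g. Qed.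
Lemma quo_1mul : right_id quo_one quo_mul.
Proof. by elim/quotW=> x; rewrite /quo_one quo_mulE mulg1. Qed.
Lemma quo_mulV : left_inverse quo_one quo_inv quo_mul.
Proof. by elim/quotW=> x; rewrite quo_invE quo_mulE mulVg. Qed.
Lemma quo_Vmul : right_inverse quo_one quo_inv quo_mul.
Proof. by elim/quotW=> x; rewrite quo_invE quo_mulE mulgV. Qed.

HB.instance Definition _ := isGroup.Build quo
  quo_mulA quo_mul1 quo_1mul quo_mulV quo_Vmul.

Definition quo_proj (x : G) : quo := \pi_quo x.

Lemma quo_projM : {morph quo_proj : x y / x * y}.
Proof. by move=> x y; rewrite /quo_proj -quo_mulE. Qed.

End Quotient.

(* (i, false) is the i-th generator and (i, true) is its formal inverse. *)
Definition letter (k : nat) : Type := ('I_k * bool)%type.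
HB.instance Definition _ k := Choice.on (letter k).

Definition word (k : nat) : Type := seq (letter k).
HB.instance Definition _ k := Choice.on (word k).

Definition inv_letter k (a : letter k) : letter k := (a.1, ~~ a.2).

Definition inv_word k (w : word k) : word k := rev (map (@inv_letter k) w).

Inductive word_eq (k : nat) : word k -> word k -> Prop :=
| word_eq_refl w : word_eq w w
| word_eq_sym v w : word_eq v w -> word_eq w v
| word_eq_trans u v w : word_eq u v -> word_eq v w -> word_eq u w
| word_eq_cancel u v a : word_eq (u ++ [:: a, inv_letter a & v]) (u ++ v).

Section FreeGroup.
Variable k : nat.

Lemma inv_letterK : involutive (@inv_letter k).
Proof. by case=> i b; rewrite /inv_letter /= negbK. Qed.

Lemma word_eq_cat (u u' v v' : word k) :
  word_eq u u' -> word_eq v v' -> word_eq (u ++ v) (u' ++ v').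
Proof.
move=> uu' vv'; apply: (@word_eq_trans _ _ (u' ++ v)).
  elim: uu' => [w|x y _ IH|x y z _ IH1 _ IH2|x y a].
  - exact: word_eq_refl.
  - exact: word_eq_sym.
  - exact: word_eq_trans IH1 IH2.
  - by rewrite -!catA; apply: word_eq_cancel.
elim: vv' => [w|x y _ IH|x y z _ IH1 _ IH2|x y a].
- exact: word_eq_refl.
- exact: word_eq_sym.
- exact: word_eq_trans IH1 IH2.
- by rewrite !catA; apply: word_eq_cancel.
Qed.

Lemma inv_word_cat (u v : word k) : inv_word (u ++ v) = inv_word v ++ inv_word u.
Proof. by rewrite /inv_word map_cat rev_cat. Qed.

Lemma inv_wordK : involutive (@inv_word k).
Proof.
by move=> u; rewrite /inv_word map_rev revK -map_comp map_id_in // => a _ /=;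
  rewrite inv_letterK.
Qed.

Lemma word_eq_inv (u v : word k) :
  word_eq u v -> word_eq (inv_word u) (inv_word v).
Proof.
elim=> [w|x y _ IH|x y z _ IH1 _ IH2|x y a].
- exact: word_eq_refl.
- exact: word_eq_sym.
- exact: word_eq_trans IH1 IH2.
rewrite -[[:: a, _ & y]]/([:: a; inv_letter a] ++ y) !inv_word_cat -catA.
rewrite {2}/inv_word /= /rev /= inv_letterK.
exact: (word_eq_cancel (inv_word y) (inv_word x) a).
Qed.

Lemma word_eqV (u : word k) : word_eq (u ++ inv_word u) [::].
Proof.
elim: u => [|a u IHu]; first exact: word_eq_refl.
rewrite -[a :: u]/([:: a] ++ u) inv_word_cat -catA catA -[X in word_eq X]catA.
apply: (@word_eq_trans _ _ ([:: a] ++ ([::] ++ inv_word [:: a]))).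
  apply: word_eq_cat; first exact: word_eq_refl.
  by rewrite catA; apply: word_eq_cat => //; apply: word_eq_refl.
exact: (word_eq_cancel [::] [::] a).
Qed.

Definition word_rel (u v : word k) : bool := `[< word_eq u v >].

Lemma word_rel_refl : reflexive word_rel.
Proof. by move=> u; apply/asboolP; apply: word_eq_refl. Qed.

Lemma word_rel_sym : symmetric word_rel.
Proof.
by move=> u v; apply/idP/idP => /asboolP h; apply/asboolP; apply: word_eq_sym.
Qed.

Lemma word_rel_trans : transitive word_rel.
Proof.
move=> v u w /asboolP uv /asboolP vw; apply/asboolP.
exact: word_eq_trans uv vw.
Qed.

Canonical word_equiv :=
  EquivRel word_rel word_rel_refl word_rel_sym word_rel_trans.

Definition freeGroup : Type := {eq_quot word_rel}.
HB.instance Definition _ := Choice.on freeGroup.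
HB.instance Definition _ := EqQuotient.on freeGroup.

Definition free_one : freeGroup := \pi_freeGroup [::].
Definition free_mul (a b : freeGroup) : freeGroup :=
  \pi_freeGroup (repr a ++ repr b).
Definition free_inv (a : freeGroup) : freeGroup :=
  \pi_freeGroup (inv_word (repr a)).

Lemma free_eqP (u v : word k) : \pi_freeGroup u = \pi_freeGroup v <-> word_eq u v.
Proof. by split=> [/eqmodP/asboolP | h] //; apply/eqmodP/asboolP. Qed.

Lemma free_repr (u : word k) : word_eq u (repr (\pi_freeGroup u)).
Proof. by apply/free_eqP; rewrite reprK. Qed.

Lemma free_mulE (u v : word k) :
  free_mul (\pi u) (\pi v) = \pi_freeGroup (u ++ v).
Proof. by apply/esym/free_eqP; apply: word_eq_cat; apply: free_repr. Qed.

Lemma free_invE (u : word k) : free_inv (\pi u) = \pi_freeGroup (inv_word u).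
Proof. by apply/esym/free_eqP; apply: word_eq_inv; apply: free_repr. Qed.

Lemma free_mulA : associative free_mul.
Proof.
by elim/quotW=> x; elim/quotW=> y; elim/quotW=> z; rewrite !free_mulE catA.
Qed.
Lemma free_mul1 : left_id free_one free_mul.
Proof. by elim/quotW=> x; rewrite /free_one free_mulE. Qed.
Lemma free_1mul : right_id free_one free_mul.
Proof. by elim/quotW=> x; rewrite /free_one free_mulE cats0. Qed.
Lemma free_Vmul : right_inverse free_one free_inv free_mul.
Proof.
by elim/quotW=> x; rewrite free_invE free_mulE; apply/free_eqP/word_eqV.
Qed.
Lemma free_mulV : left_inverse free_one free_inv free_mul.
Proof.
elim/quotW=> x; rewrite free_invE free_mulE; apply/free_eqP.
by rewrite -{2}[x]inv_wordK; apply: word_eqV.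
Qed.

HB.instance Definition _ := isGroup.Build freeGroup
  free_mulA free_mul1 free_1mul free_mulV free_Vmul.

Definition free_gen (i : 'I_k) : freeGroup := \pi_freeGroup [:: (i, false)].

Definition free_letter (a : letter k) : freeGroup :=
  if a.2 then (free_gen a.1)^-1 else free_gen a.1.

Lemma free_letterE a : free_letter a = \pi_freeGroup [:: a].
Proof. by case: a => i [] //; rewrite /free_letter /= [LHS]free_invE. Qed.

Lemma free_ind (P : freeGroup -> Prop) :
  P 1 -> (forall a x, P x -> P (free_letter a * x)) -> forall x, P x.
Proof.
move=> P1 PM; elim/quotW; elim=> [|a w IHw]; first exact: P1.
have -> : \pi_freeGroup (a :: w) = free_letter a * \pi_freeGroup w.
  by rewrite free_letterE; apply/esym/(free_mulE [:: a] w).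
exact: PM.
Qed.

Lemma free_universal (H : groupType) (f : 'I_k -> H) :
  exists! F : freeGroup -> H,
    {morph F : x y / x * y} /\ (forall i, F (free_gen i) = f i).
Proof.
pose fl (a : letter k) : H := if a.2 then (f a.1)^-1 else f a.1.
pose fw (w : word k) : H := foldr (fun a h => fl a * h) 1 w.
have fw_cat u v : fw (u ++ v) = fw u * fw v.
  by elim: u => [|a u IHu] /=; rewrite ?mul1g // IHu mulgA.
have fw_eq u v : word_eq u v -> fw u = fw v.
  elim=> [//|//|x y z _ -> _ -> //|x y a].
  rewrite !fw_cat /=; congr (_ * _); rewrite mulgA; case: a => i [];
  by rewrite /fl /= ?mulgV ?mulVg mul1g.
pose F (x : freeGroup) : H := fw (repr x).
have FE w : F (\pi w) = fw w by apply/esym/fw_eq/free_repr.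
have FM : {morph F : x y / x * y}.
  elim/quotW=> x; elim/quotW=> y.
  by rewrite -[X in F X]/(free_mul _ _) free_mulE !FE fw_cat.
exists F; split; first by split=> // i; rewrite FE /= mulg1.
move=> F' [F'M F'g]; apply/funext.
have F'1 : F' 1 = 1 by apply: (mulgI (F' 1)); rewrite -F'M !mulg1.
have F'V x : F' x^-1 = (F' x)^-1.
  by apply: (mulIg (F' x)); rewrite -F'M !mulVg.
have F1 : F 1 = 1 by rewrite [F 1]FE.
apply: free_ind => [|a x IHx]; first by rewrite F1.
rewrite FM F'M IHx; congr (_ * _).
by rewrite free_letterE FE /= mulg1 -free_letterE; case: a => i [];
  rewrite /free_letter /fl /= ?F'V F'g.
Qed.

End FreeGroup.

Definition lps_ns (G : groupType) (p i : nat) : normalSubgroup G :=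
  NormalSubgroup (lps_normal G p i).

Section Finiteness.
Variables (p : nat) (p0 : (0 < p)%N).

Lemma central_span (Q : groupType) (A : seq Q) :
  (forall a, a \in A -> a ^+ p = 1 /\ (forall x, commute a x)) ->
  exists2 L : seq Q, 1 \in L &
    forall a l, a \in A -> l \in L -> a * l \in L.
Proof.
elim: A => [|a A IHA] HA; first by exists [:: 1]; rewrite ?mem_seq1.
have [|L L1 LA] := IHA; first by move=> b bA; apply: HA; rewrite inE bA orbT.
have [ap aC] := HA a (mem_head _ _).
exists [seq a ^+ e * l | e <- iota 0 p, l <- L].
  by apply/allpairsP; exists (0%N, 1); rewrite mem_iota mulg1.
move=> b _ bA /allpairsP[[e l] /= [ep lL ->]]; rewrite mem_iota add0n /= in ep.
have [->|ba] := eqVneq b a.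
  rewrite mulgA -expgS; have [eq_p|ne_p] := eqVneq e.+1 p.
    by rewrite eq_p ap; apply/allpairsP; exists (0%N, l); rewrite mem_iota.
  apply/allpairsP; exists (e.+1, l); rewrite mem_iota /= add0n.
  by rewrite ltn_neqAle ne_p ep.
move: bA; rewrite inE (negPf ba) /= => bA.
apply/allpairsP; exists (e, b * l); rewrite mem_iota /= add0n ep LA //.
have [|_ bC] := HA b; first by rewrite inE bA orbT.
by split=> //; rewrite !mulgA bC.
Qed.

Lemma lps_stepX (G : groupType) (H : set G) x : H x -> lps_step p H (x ^+ p).
Proof.
move=> Hx; exists (x ^+ p); first by apply: sub_gen; exists x.
by exists 1; rewrite ?mulg1 //; apply: subgroup1; apply: gen_subgroup.
Qed.

Lemma lps_stepR (G : groupType) (H : set G) x y :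
  H x -> lps_step p H [~ x, y].
Proof.
move=> Hx; exists 1; first by apply: subgroup1; apply: gen_subgroup.
exists [~ x, y]; last by rewrite mul1g.
by apply: sub_gen; exists x => //; exists y.
Qed.

Lemma quo_proj_eq1 (G : groupType) (N : normalSubgroup G) x :
  nsubset N x -> quo_proj N x = 1.
Proof.
move=> Nx; apply/esym/quo_eqP; rewrite invg1 mul1g.
exact: Nx.
Qed.

Lemma lps_finite (k i : nat) :
  exists S : seq (freeGroup k), forall x, exists2 s, s \in S &
    lps (freeGroup k) p i (s^-1 * x).
Proof.
case: i => [|i]; first by exists [:: 1] => x; exists 1; rewrite ?mem_seq1.
elim: i => [|i [S HS]]; first by exists [:: 1] => x; exists 1; rewrite ?mem_seq1.
set N' := lps_ns (freeGroup k) p i.+2.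
have nN := lps_normal (freeGroup k) p i.+1.
pose pr := quo_proj N'.
have prM : {morph pr : x y / x * y} by apply: quo_projM.
pose s0 (x : freeGroup k) : freeGroup k := xget 1 [set s | s \in S /\ lps (freeGroup k) p i.+1 (s^-1 * x)].
have s0P x : s0 x \in S /\ lps (freeGroup k) p i.+1 ((s0 x)^-1 * x).
  rewrite /s0; case: xgetP => [y _ //|h].
  by have [s sS sx] := HS x; case: (h s).
pose al (x : freeGroup k) := pr ((s0 x)^-1 * x).
pose A := al 1 :: [seq al (free_letter a * s) |
  a <- enum {: 'I_k * bool}, s <- S].
have alP x : al x ^+ p = 1 /\ (forall y, commute (al x) y).
  have [_ Nx] := s0P x; split.
    have <- : pr (((s0 x)^-1 * x) ^+ p) = al x ^+ p.
      elim: p => [|q IHq]; last by rewrite !expgS prM IHq.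
      by rewrite !expg0; apply: quo_proj_eq1; apply: subgroup1; case: (nsubsetP N').
    by apply: quo_proj_eq1; apply: lps_stepX.
  elim/quotW=> y; rewrite -[\pi y]/(pr y) /commute /al -!prM.
  apply/esym/quo_eqP; set z := _ * x.
  have -> : (y * z)^-1 * (z * y) = [~ z, y].
    by rewrite invgM /commg /conjg !mulgA.
  exact: lps_stepR.
have [L L1 LA] : exists2 L : seq (quo N'), 1 \in L &
    forall a l, a \in A -> l \in L -> a * l \in L.
  apply: central_span => a; rewrite inE => /predU1P[->|]; first exact: alP.
  by case/allpairsP=> -[b s] [_ _ ->]; apply: alP.
have S0 x : pr x = pr (s0 x) * al x by rewrite /al -prM mulVKg.
exists [seq s * repr l | s <- S, l <- L] => x.
suff [s sS [l lL xE]] : exists2 s, s \in S & exists2 l, l \in L & pr x = pr s * l.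
  exists (s * repr l); first by apply/allpairsP; exists (s, l).
  have xE' : pr (s * repr l) = pr x.
    by rewrite prM xE; congr (_ * _); apply: reprK.
  by have [+ _] := quo_eqP N' (s * repr l) x; apply.
elim/free_ind: x => [|a x [s sS [l lL xE]]].
  exists (s0 1); first by have [] := s0P 1.
  by exists (al 1); rewrite -?S0 // -[al 1]mulg1 LA // mem_head.
exists (s0 (free_letter a * s)); first by have [] := s0P (free_letter a * s).
exists (al (free_letter a * s) * l).
  apply: LA => //; rewrite inE; apply/orP; right; apply/allpairsP.
  by exists (a, s); rewrite mem_enum.
by rewrite prM xE !mulgA -prM -S0.
Qed.

Lemma gamma_finite (k n : nat) :
  exists S : seq (quo (lps_ns (freeGroup k) p n.+1)), forall x, x \in S.
Proof.
have [S HS] := lps_finite k n.+1.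
exists [seq quo_proj _ s | s <- S]; elim/quotW=> x.
have [s sS /(quo_eqP (lps_ns (freeGroup k) p n.+1)) sx] := HS x.
by apply/mapP; exists s.
Qed.

End Finiteness.

(* Primality of p is an argument because it makes the quotient finite. *)
Definition Gamma (p : nat) (p_prime : prime p) (k n : nat) : Type :=
  quo (lps_ns (freeGroup k) p n.+1).

Section GammaFinGroup.
Variables (p : nat) (p_prime : prime p) (k n : nat).
Local Notation T := (Gamma p_prime k n).

HB.instance Definition _ := monoid.Group.on T.

Definition gamma_enum : seq T :=
  undup (projT1 (cid (gamma_finite (prime_gt0 p_prime) k n))).

Lemma mem_gamma_enum (x : T) : x \in gamma_enum.
Proof.
rewrite mem_undup.
exact: (projT2 (cid (gamma_finite (prime_gt0 p_prime) k n))).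
Qed.

Lemma gamma_indexK :
  cancel (fun x : T => index x gamma_enum) (nth 1 gamma_enum).
Proof. by move=> x; rewrite nth_index // mem_gamma_enum. Qed.

Lemma gamma_enumP : Finite.axiom gamma_enum.
Proof.
by apply: Finite.uniq_enumP; [exact: undup_uniq | exact: mem_gamma_enum].
Qed.

HB.instance Definition _ : isCountable T := CanIsCountable gamma_indexK.

HB.instance Definition _ := fintype.isFinite.Build T gamma_enumP.
End GammaFinGroup.

Local Open Scope ring_scope.

(* A complex Hilbert space of arbitrary dimension: a Banach space over R[i]
   whose norm comes from an inner product. *)
Record hilbertSpace (R : realType) := HilbertSpace {
  hspace :> completeNormedModType R[i];
  hdot : {dot hspace for Num.conj};
  hdotE : forall v : hspace, hdot v v = `|v| ^+ 2
}.

(* The norm of the library takes values in R[i]. *)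
Definition hnorm (R : realType) (H : hilbertSpace R) (v : H) : R :=
  complex.Re `|v|.

(* Invertibility of the operators follows from urep1 and urepM. *)
Record unitaryRep (R : realType) (G : finGroupType) := UnitaryRep {
  uspace :> hilbertSpace R;
  urep : G -> {linear uspace -> uspace};
  urep1 : forall v, urep 1%g v = v;
  urepM : forall (x y : G) v, urep (x * y)%g v = urep x (urep y v);
  urep_dot : forall (x : G) u v, hdot uspace (urep x u) (urep x v) = hdot uspace u v
}.

Definition no_invariant_vectors (R : realType) (G : finGroupType)
    (rho : unitaryRep R G) : Prop :=
  forall v : rho, (forall g : G, urep rho g v = v) -> v = 0.

(* A finite multiset is represented by a sequence, up to permutation. *)
Definition avg_displacement (R : realType) (G : finGroupType)
    (rho : unitaryRep R G) (T : seq G) (v : rho) : R :=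
  (size T)%:R^-1 * \sum_(t <- T) hnorm (urep rho t v - v) ^+ 2 / hnorm v ^+ 2.

Local Open Scope ereal_scope.

Definition rep_kazhdan_inf (R : realType) (G : finGroupType)
    (rho : unitaryRep R G) (T : seq G) : \bar R :=
  ereal_inf [set (avg_displacement T v)%:E | v in [set v : rho | v != 0%R]].

Definition kazhdan_inf (R : realType) (G : finGroupType) (T : seq G) : \bar R :=
  ereal_inf [set e | exists2 rho : unitaryRep R G,
    no_invariant_vectors rho & e = rep_kazhdan_inf rho T].

Definition is_avg_kazhdan_constant (R : realType) (G : finGroupType)
    (T : seq G) (eps : R) : Prop :=
  (0 < eps)%R /\ eps%:E <= kazhdan_inf R T.

Definition generates (G : finGroupType) (T : seq G) : Prop :=
  <<[set t in T]%SET>>%g = [set: G]%SET.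

Definition g_admissible (R : realType) (G : finGroupType) (eps : R)
    (N : nat) : Prop :=
  exists T : seq G, [/\ generates T, (size T <= N)%N &
    exists2 c : R, (eps <= c)%R & is_avg_kazhdan_constant T c].

(* The least admissible integer, read as +oo when there is none. *)
Definition g_eps (R : realType) (G : finGroupType) (eps : R) : \bar R :=
  ereal_inf [set N%:R%:E | N in [set N | g_admissible G eps N]].

(* Main.v *)
(* The quotient map sends lps_3 to 1, so Gamma = Gamma_{k,2} is generated by k
   elements x_i, has central commutators and exponent m = p^2.  Take T to be the
   x_i together with words x_1^{a_1} ... x_k^{a_k}, where a runs over a family t
   of O(k) vectors of V = (Z/m)^k whose nontrivial character sums have real part
   at most |t|/16.  Decomposing along the centre, it suffices to treat vectors v
   on which the centre acts by scalars.  If commutators fix v, then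
   a |-> <x^a v, v> is positive definite on V with mean 0.  Otherwise
   F(a) = |<x^a v, v>|^2 is positive definite on V by the Schur product theorem
   and has mean at most |v|^4/2.  A positive definite function is a nonnegative
   combination of characters, so its average over t exceeds its mean by at most
   1/16 of its value at 0.  In both cases the average of Re <x^a v, v> over t is
   at most 3/4 |v|^2, so the average displacement over t is at least 1/2, and at
   least 1/4 over T.  Finally log |Gamma| grows like k^2, because products of
   commutators of generators are separated by maps to Heisenberg groups. *)
Require Import Defs.
From HB Require Import structures.
From mathcomp Require Import all_boot all_order all_algebra all_fingroup.
From mathcomp Require Import sesquilinear complex cyclic commutator separable.
From mathcomp Require Import cyclotomic lra ring zify.
From mathcomp Require Import all_classical all_reals all_analysis.

Set Implicit Arguments.
Unset Strict Implicit.
Unset Printing Implicit Defensive.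

Import Order.TTheory GRing.Theory Num.Theory.

Local Open Scope ring_scope.

(** * Characters of (Z/m)^k *)

(** In characteristic 0 the polynomial X^n - 1 is separable, so it has n distinct roots, and n
    distinct n-th roots of unity include a primitive one. *)
Lemma prim_root_exists (C : numClosedFieldType) n :
  (0 < n)%N -> exists z : C, n.-primitive_root z.
Proof.
move=> n_gt0; pose p : {poly C} := 'X^n - 1.
have [r Dp] := closed_field_poly_normal p.
rewrite (monicP _) ?monicXnsubC // scale1r in Dp.
have rn1 : all n.-unity_root r by apply/allP=> z; rewrite -root_prod_XsubC -Dp.
have sz_r : (n < (size r).+1)%N.
  by rewrite -(size_prod_XsubC r id) -Dp size_XnsubC.
have [|z] := hasP (has_prim_root n_gt0 rn1 _ sz_r); last by exists z.
by rewrite -separable_prod_XsubC -Dp separable_Xn_sub_1 // pnatr_eq0 -lt0n.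
Qed.

Section Characters.
Variables (C : numClosedFieldType) (q : nat) (w : C).
Hypothesis w_prim : q.+2.-primitive_root w.
Implicit Types x y : 'I_q.+2.

Definition echar x : C := w ^+ x.

Lemma echarD x y : echar (x + y) = echar x * echar y.
Proof. by rewrite /echar -exprD -(prim_expr_mod w_prim (x + y)%N). Qed.

Lemma echar0 : echar 0 = 1.
Proof. by rewrite /echar expr0. Qed.

Lemma echar_eq1 x : (echar x == 1) = (x == 0).
Proof.
rewrite /echar -(prim_order_dvd w_prim); apply/idP/eqP => [|->]; last exact: dvdn0.
by move=> d; apply/val_inj => /=; rewrite -(modn_small (ltn_ord x)); apply/eqP.
Qed.

Lemma norm_echar x : `|echar x| = 1.
Proof.
have w1 : `|w| = 1.
  apply/eqP; rewrite -(@pexpr_eq1 _ _ q.+2) ?normr_ge0 //.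
  by rewrite -normrX prim_expr_order // normr1.
by rewrite /echar normrX w1 expr1n.
Qed.

Lemma echarN x : echar (- x) = (echar x)^*.
Proof.
have e0 : echar x != 0 by rewrite -normr_eq0 norm_echar oner_eq0.
apply: (mulfI e0); rewrite -echarD subrr echar0.
by rewrite -normCK norm_echar expr1n.
Qed.

Lemma echarMn x n : echar (x *+ n) = echar x ^+ n.
Proof. by elim: n => [|n IHn]; rewrite ?mulr0n ?echar0 // mulrS echarD IHn exprS. Qed.

Variable k : nat.
Local Notation V := 'rV['I_q.+2]_k.
Implicit Types a b c : V.

Definition rdot a b : 'I_q.+2 := \sum_i a 0 i * b 0 i.

Definition chi b a : C := echar (rdot b a).

Lemma rdotC a b : rdot a b = rdot b a.
Proof. by apply: eq_bigr => i _; rewrite mulrC. Qed.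

Lemma rdotDr a b c : rdot a (b + c) = rdot a b + rdot a c.
Proof. by rewrite -big_split; apply: eq_bigr => i _; rewrite mxE mulrDr. Qed.

Lemma rdotNr a b : rdot a (- b) = - rdot a b.
Proof. by rewrite /rdot -sumrN; apply: eq_bigr => i _; rewrite mxE mulrN. Qed.

Lemma chiC a b : chi a b = chi b a.
Proof. by rewrite /chi rdotC. Qed.

Lemma chiD b a c : chi b (a + c) = chi b a * chi b c.
Proof. by rewrite /chi rdotDr echarD. Qed.

Lemma chiN b a : chi b (- a) = (chi b a)^*.
Proof. by rewrite /chi rdotNr echarN. Qed.

Lemma chi0 b : chi b 0 = 1.
Proof. by rewrite /chi /rdot big1 ?echar0 // => i _; rewrite mxE mulr0. Qed.

Lemma chi0l a : chi 0 a = 1.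
Proof. by rewrite chiC chi0. Qed.

Lemma norm_chi b a : `|chi b a| = 1.
Proof. exact: norm_echar. Qed.

(** If the coordinate b_i is nonzero, translation by the i-th basis vector multiplies the sum by a
    factor other than 1, so the sum vanishes. *)
Lemma sum_chi b : \sum_a chi b a = #|{: V}|%:R * (b == 0)%:R.
Proof.
have [->|b0] := eqVneq b 0.
  under eq_bigr do rewrite chi0l.
  by rewrite sumr_const mulr1.
rewrite mulr0; have [i bi] : exists i, b 0 i != 0 by apply/rV0Pn.
have e1 : chi b (delta_mx 0 i) != 1.
  rewrite /chi (_ : rdot b (delta_mx 0 i) = b 0 i) ?echar_eq1 //.
  rewrite /rdot (bigD1 i) //= big1 => [|j ji]; first by rewrite mxE !eqxx mulr1 addr0.
  by rewrite mxE (negPf ji) mulr0.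
apply/eqP; have := subrr (\sum_a chi b a).
rewrite {1}(reindex_inj (addrI (delta_mx 0 i))) /=.
under eq_bigr do rewrite chiD.
rewrite -mulr_sumr -{2}[\sum_a _]mul1r -mulrBl => /eqP.
by rewrite mulf_eq0 subr_eq0 (negPf e1).
Qed.

Definition fourier (phi : V -> C) b : C := \sum_c chi b (- c) * phi c.

Lemma card_rV_neq0 : #|{: V}|%:R != 0 :> C.
Proof. by rewrite pnatr_eq0 -lt0n; apply/card_gt0P; exists 0. Qed.

Lemma fourierK phi a :
  \sum_b fourier phi b * chi b a = #|{: V}|%:R * phi a.
Proof.
under eq_bigr => b _ do rewrite /fourier mulr_suml.
rewrite exchange_big /= (bigD1 a) //= [X in _ + X]big1 => [|c ca].
  under eq_bigr => b _ do rewrite mulrAC -chiD addNr chi0 mul1r.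
  by rewrite sumr_const mulr_natl addr0.
under eq_bigr => b _ do rewrite mulrAC -chiD chiC.
by rewrite -mulr_suml sum_chi addrC subr_eq0 eq_sym (negPf ca) mulr0 mul0r.
Qed.

Lemma fourier_at0 phi : fourier phi 0 = \sum_c phi c.
Proof. by apply: eq_bigr => c _; rewrite chi0l mul1r. Qed.

(** The right side is the Hermitian form of the kernel phi (a - c) at a vector of character values,
    so positive semidefinite kernels have nonnegative Fourier transform. *)
Lemma fourier_autocorrelation phi b : #|{: V}|%:R * fourier phi b =
  \sum_a \sum_c chi b (- a) * chi b c * phi (a - c).
Proof.
rewrite exchange_big mulr_natl -sumr_const; apply: eq_bigr => c _.
rewrite [in RHS](reindex_inj (addIr c)); apply: eq_bigr => a _ /=.
by rewrite addrK -chiD opprD addrNK.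
Qed.

(* A function with nonnegative Fourier transform is a nonnegative combination of
   characters, so a one-sided bound on nontrivial characters is enough. *)
Lemma positive_sum_le phi (s : seq V) (d : C) :
  0 <= d -> (forall b, 0 <= fourier phi b) ->
  (forall b, b != 0 -> 'Re (\sum_(a <- s) chi b a) <= d) ->
  'Re (\sum_(a <- s) phi a) <=
    (size s)%:R * (\sum_a phi a) / #|{: V}|%:R + d * phi 0.
Proof.
move=> d0 phi_ge0 sd; have V0 := card_rV_neq0.
have Vgt0 : 0 < #|{: V}|%:R :> C by rewrite lt0r V0 ler0n.
rewrite -(ler_pM2l Vgt0) mulrDr mulrCA divff // mulr1 mulrCA -fourierK.
have -> : #|{: V}|%:R * 'Re (\sum_(a <- s) phi a) =
    \sum_b fourier phi b * 'Re (\sum_(a <- s) chi b a).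
  have -> : #|{: V}|%:R * 'Re (\sum_(a <- s) phi a) =
      'Re (\sum_(a <- s) \sum_b fourier phi b * chi b a).
    rewrite -ReMl ?mulr_sumr; last by rewrite ger0_real // ler0n.
    by congr ('Re _); apply: eq_bigr => a _; rewrite fourierK.
  rewrite exchange_big /= raddf_sum /=; apply: eq_bigr => b _.
  by rewrite -mulr_sumr ReMl // ger0_real.
(* The coefficient at b = 0 produces the mean of phi. Every other coefficient has weight at most d,
   and by inversion all coefficients add up to #|V| phi(0). *)
rewrite (bigD1 0) //= [X in _ <= _ + d * X](bigD1 0) //= chi0 mulr1 mulrDr addrA.
apply: lerD; last first.
  rewrite mulr_sumr; apply: ler_sum => b b0; rewrite chi0 mulr1 mulrC.
  by apply: ler_wpM2r => //; apply: sd.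
rewrite -fourier_at0 -[X in X <= _]addr0; apply: lerD; last exact: mulr_ge0.
rewrite mulrC; apply: ler_wpM2r => //.
under eq_bigr do rewrite chi0l.
by rewrite big_const_seq count_predT iter_addr_0 (Creal_ReP _ _) // realn.
Qed.

End Characters.

(** * Inner products and unitary actions of groups of exponent m *)

Section InnerProduct.
Variables (C : numClosedFieldType) (U : lmodType C) (form : {dot U for Num.conj}).
Local Notation "''[' u , v ]" := (form u%R v%R) : ring_scope.
Local Notation "''[' u ]" := '[u, u]%R : ring_scope.
Implicit Types u v x : U.

Lemma dotC u v : '[u, v] = '[v, u]^*.
Proof. by rewrite hermC /= expr0 mul1r. Qed.

Lemma dotZl a u v : '[a *: u, v] = a * '[u, v].
Proof. exact: linearZl_LR. Qed.

Lemma dotZr a u v : '[u, a *: v] = a^* * '[u, v].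
Proof. exact: linearZr_LR. Qed.

Lemma cauchy_schwarz u v : `|'[u, v]| ^+ 2 <= '[u] * '[v].
Proof.
have [->|v0] := eqVneq v 0; first by rewrite linear0r normr0 expr0n mulr_ge0.
pose a := '[u, v] / '[v]; pose u1 := u - a *: v.
have ou : '[u1, v] = 0 by rewrite linearBl /= dotZl divfK ?subrr // dnorm_eq0.
have -> : u = u1 + a *: v by rewrite subrK.
rewrite linearDl /= ou add0r dotZl normrM exprMn (ger0_norm (dnorm_ge0 _ _)).
rewrite hnormDd /=; last by rewrite dotZr ou mulr0.
by rewrite dnormZ mulrDl expr2 mulrA lerDr mulr_ge0.
Qed.

(** Schur product theorem for two Gram matrices, by elimination: splitting off the projections onto
    one nonzero u_i contributes a multiple of a squared norm and leaves fewer nonzero vectors. *)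
Lemma schur_ge0 (I : finType) (u x : I -> U) :
  0 <= \sum_i \sum_j '[u i, u j] * '[x i, x j]^*.
Proof.
have [n] := ubnP #|[pred i | u i != 0]|.
elim: n u => // n IHn u ltn.
have [i0 /= ui0|u0] := pickP [pred i | u i != 0]; last first.
  rewrite big1 // => i _; rewrite big1 // => j _.
  by have /negbFE/eqP-> := u0 i; rewrite linear0l mul0r.
pose e := u i0; pose c i := '[u i, e] / '[e]; pose u' i := u i - c i *: e.
have e0 : '[e] != 0 by rewrite dnorm_eq0.
have oe i : '[u' i, e] = 0 by rewrite linearBl /= dotZl divfK ?subrr.
have uE i j : '[u i, u j] = '[e] * (c i * (c j)^*) + '[u' i, u' j].
  have uD l : u l = c l *: e + u' l by rewrite addrC subrK.
  rewrite {1}(uD i) {1}(uD j); move: (u' i) (u' j) (oe i) (oe j) => a b ae be.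
  rewrite linearDl /= !linearDr /= !dotZl !dotZr ['[e, b]]dotC ae be conjC0.
  ring.
under eq_bigr => i _ do [under eq_bigr => j _ do rewrite uE mulrDl; rewrite big_split /=].
rewrite big_split /=; apply: addr_ge0; last first.
  apply: IHn; rewrite ltnS in ltn; apply: leq_trans ltn; apply/proper_card/properP; split.
    apply/fintype.subsetP => i; rewrite !inE; apply: contraNneq => ui.
    by rewrite /u' /c ui linear0l mul0r scale0r subr0.
  exists i0; rewrite !inE // /u' /c -/e divff // scale1r subrr eqxx //.
have -> : \sum_i \sum_j '[e] * (c i * (c j)^*) * '[x i, x j]^* =
    '[e] * '[\sum_i (c i)^* *: x i].
  rewrite exchange_big /= linear_sumlz /= mulr_sumr; apply: eq_bigr => j _.
  rewrite linear_sumr /= mulr_sumr; apply: eq_bigr => i _.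
  rewrite dotZl dotZr conjCK -dotC; ring.
by rewrite mulr_ge0.
Qed.

Variables (G : finGroupType) (q : nat) (act : G -> {linear U -> U}).
Hypothesis act1 : forall v, act 1%g v = v.
Hypothesis actM : forall (x y : G) v, act (x * y)%g v = act x (act y v).
Hypothesis act_dot : forall (x : G) u v, '[act x u, act x v] = '[u, v].
Hypothesis expG : forall x : G, (x ^+ q.+2 = 1)%g.
Implicit Types g h y z : G.

Lemma act_dotV g u v : '[act g u, v] = '[u, act g^-1%g v].
Proof. by rewrite -(act_dot g^-1%g) -actM mulVg act1. Qed.

Variable w : C.
Hypothesis w_prim : q.+2.-primitive_root w.
Local Notation e := (echar w).
Local Notation m := (q.+2).
Implicit Types l j c : 'I_q.+2.

Lemma sum_echar j : \sum_l e (l * j) = m%:R * (j == 0)%:R.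
Proof.
have [->|j0] := eqVneq j 0.
  under eq_bigr do rewrite mulr0 echar0.
  by rewrite sumr_const card_ord mulr1.
rewrite mulr0; apply/eqP; have := subrr (\sum_l e (l * j)).
rewrite {1}(reindex_inj (addrI (1 : 'I_q.+2))) /=.
under eq_bigr do rewrite mulrDl mul1r (echarD w_prim).
rewrite -mulr_sumr -{2}[\sum_l _]mul1r -mulrBl => /eqP.
by rewrite mulf_eq0 subr_eq0 (echar_eq1 w_prim) (negPf j0).
Qed.

Lemma parseval (c : 'I_q.+2 -> C) :
  \sum_j `|\sum_l e (l * j) * c l| ^+ 2 = m%:R * \sum_l `|c l| ^+ 2.
Proof.
have -> : \sum_j `|\sum_l e (l * j) * c l| ^+ 2 =
    \sum_j \sum_l \sum_l' e (j * (l - l')) * (c l * (c l')^*).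
  apply: eq_bigr => j _; rewrite normCK rmorph_sum mulr_suml /=.
  apply: eq_bigr => l _; rewrite mulr_sumr; apply: eq_bigr => l' _.
  rewrite [j * _]mulrC mulrBl (echarD w_prim) (echarN w_prim) rmorphM /=; ring.
rewrite exchange_big mulr_sumr /=; apply: eq_bigr => l _.
rewrite exchange_big (bigD1 l) //= [X in _ + X]big1 => [|l' ll'].
  by rewrite -mulr_suml normCK addr0 sum_echar subrr eqxx mulr1.
by rewrite -mulr_suml sum_echar subr_eq0 eq_sym (negPf ll') mulr0 mul0r.
Qed.

(** Spectral projection of [act g] onto the eigenvalue w^l, written as an average over powers of g
    because g^m = 1. *)
Definition eproj g l v : U :=
  m%:R^-1 *: \sum_j e (- (l * j)) *: act (g ^+ j)%g v.

Lemma eproj_is_linear g l : linear (eproj g l).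
Proof.
move=> a u v; rewrite /eproj scalerA mulrC -scalerA -scalerDr; congr (_ *: _).
rewrite scaler_sumr -big_split; apply: eq_bigr => j _ /=.
by rewrite linearP scalerDr !scalerA mulrC.
Qed.
HB.instance Definition _ g l :=
  GRing.isLinear.Build C U U _ (eproj g l) (eproj_is_linear g l).

Lemma sum_eproj g v : \sum_l eproj g l v = v.
Proof.
rewrite -scaler_sumr exchange_big /= (bigD1 0) //= [X in _ + X]big1 => [|j j0].
  under eq_bigr do rewrite mulr0 oppr0 echar0 scale1r expg0 act1.
  rewrite sumr_const card_ord addr0 -scaler_nat scalerA mulVf ?scale1r //.
rewrite -scaler_suml (eq_bigr (fun l => e (l * - j))) => [|l _].
  by rewrite sum_echar oppr_eq0 (negPf j0) mulr0 scale0r.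
by rewrite mulrN.
Qed.

Lemma expg_ordD g j l : (g ^+ (j + l)%R = g ^+ j * g ^+ l)%g.
Proof. by rewrite /= expg_mod // expgD. Qed.

Lemma act_eproj g l v : act g (eproj g l v) = e l *: eproj g l v.
Proof.
rewrite linearZ /= scalerA mulrC -scalerA; congr (_ *: _).
have gS j : (g ^+ (1 + j)%R = g * g ^+ j)%g.
  by rewrite expg_ordD; congr (_ * _)%g; apply: expg1.
rewrite linear_sum [in RHS](reindex_inj (addrI (1 : 'I_q.+2))) scaler_sumr.
apply: eq_bigr => j _; rewrite gS linearZ -actM scalerA; congr (_ *: _).
by rewrite mulrDr opprD mulr1 (echarD w_prim) mulrA -(echarD w_prim) subrr echar0 mul1r.
Qed.

Lemma eigen_orth g l l' u v :
  l != l' -> act g u = e l *: u -> act g v = e l' *: v -> '[u, v] = 0.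
Proof.
move=> ll' gu gv; have := act_dot g u v; rewrite gu gv dotZl dotZr mulrA.
rewrite -(echarN w_prim) -(echarD w_prim) => /eqP.
rewrite -[X in _ == X]mul1r -subr_eq0 -mulrBl mulf_eq0 !subr_eq0.
by rewrite (echar_eq1 w_prim) subr_eq0 (negPf ll') => /eqP.
Qed.

Lemma eproj_orth g l l' u v : l != l' -> '[eproj g l u, eproj g l' v] = 0.
Proof. by move=> /eigen_orth; apply; apply: act_eproj. Qed.

Lemma dot_eproj g u v : '[u, v] = \sum_l '[eproj g l u, eproj g l v].
Proof.
rewrite -{1}(sum_eproj g u) -{1}(sum_eproj g v) linear_sumlz /=.
apply: eq_bigr => l _; rewrite linear_sumr (bigD1 l) //= big1 ?addr0 // => l' ll'.
by rewrite eproj_orth // eq_sym.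
Qed.

Lemma dot_eprojl g l u v : '[eproj g l u, v] = '[eproj g l u, eproj g l v].
Proof.
rewrite -{1}(sum_eproj g v) linear_sumr (bigD1 l) //= big1 ?addr0 // => l' ll'.
by rewrite eproj_orth // eq_sym.
Qed.

Lemma act_eprojC g h l v : commute h g -> act h (eproj g l v) = eproj g l (act h v).
Proof.
move=> hg; rewrite linearZ linear_sum; congr (_ *: _); apply: eq_bigr => j _ /=.
by rewrite linearZ /= -!actM (commuteX _ hg).
Qed.

Lemma act_eigenX z c v i :
  act z v = e c *: v -> act (z ^+ i)%g v = e (c *+ i) *: v.
Proof.
move=> zv; rewrite (echarMn w_prim); elim: i => [|i IHi].
  by rewrite act1 scale1r.
by rewrite expgS actM IHi linearZ /= zv scalerA exprSr.
Qed.

Lemma mulrn_ord (c j : 'I_q.+2) : c *+ j = c * j.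
Proof. by rewrite -mulr_natr natr_Zp. Qed.

(** For a central commutator, y^j x = x y^j [y, x]^j. On v the last factor is the scalar
    [e (c * j)], which shifts the eigenvalue index by c. *)
Lemma eproj_shift (x y : G) c l v : (forall z, commute [~ y, x]%g z) ->
  act [~ y, x]%g v = e c *: v -> eproj y l (act x v) = act x (eproj y (l - c) v).
Proof.
move=> zC zv; rewrite linearZ linear_sum; congr (_ *: _); apply: eq_bigr => j _ /=.
rewrite linearZ /= -!actM (commgC (y ^+ j)%g x) (commXg _ (commute_sym (zC _))).
rewrite [act (_ * _ ^+ _)%g v]actM (act_eigenX _ zv) linearZ /=.
by rewrite scalerA /= -(echarD w_prim) mulrn_ord mulrBl opprB addrC.
Qed.

(** Parseval for j |-> <y^j u, v>, whose Fourier coefficients are the inner products of the spectral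
    components of u and v. *)
Lemma sum_dot_expg y u v :
  \sum_(j < m) `|'[act (y ^+ j)%g u, v]| ^+ 2 =
  m%:R * \sum_l `|'[eproj y l u, eproj y l v]| ^+ 2.
Proof.
rewrite -parseval; apply: eq_bigr => j _; congr (`|_| ^+ 2).
rewrite -{1}(sum_eproj y u) linear_sum linear_sumlz; apply: eq_bigr => l _ /=.
by rewrite -dot_eprojl -mulrn_ord -dotZl (act_eigenX _ (act_eproj _ _ _)).
Qed.

(* When [~ y, x] acts as a nontrivial scalar, x moves every eigenspace of y to a
   different one, so at each eigenvalue the spectral weights of v and x v for y
   are weights of v at two distinct eigenvalues and add up to at most |v|^2. *)
Lemma sum_dot_expg_le (x y : G) c u v : (forall z, commute [~ y, x]%g z) ->
  act [~ y, x]%g v = e c *: v -> c != 0 ->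
  \sum_(j < m) (`|'[act (y ^+ j)%g u, v]| ^+ 2 +
                 `|'[act (y ^+ j)%g u, act x v]| ^+ 2) <= m%:R * ('[u] * '[v]).
Proof.
move=> zC zv c0; rewrite big_split /= !sum_dot_expg -mulrDr.
apply: ler_wpM2l; first exact: ler0n.
rewrite (dot_eproj y u) mulr_suml -big_split /=; apply: ler_sum => l _.
apply: le_trans (lerD (cauchy_schwarz _ _) (cauchy_schwarz _ _)) _.
rewrite -mulrDr; apply: ler_wpM2l => //.
rewrite (eproj_shift _ zC zv) act_dot (dot_eproj y v v) (bigD1 l) //= lerD2l.
rewrite (bigD1 (l - c)) /= ?lerDl ?sumr_ge0 //.
by rewrite -subr_eq0 addrAC subrr add0r oppr_eq0.
Qed.

(** The bound [sum_dot_expg_le] is summed over u = g v. Translating g by y^j, respectively by x^-1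
    y^j, turns both terms into the same sum over G, hence the factor 2. *)
Lemma sum_dot_sqr_le (x y : G) c v : (forall z, commute [~ y, x]%g z) ->
  act [~ y, x]%g v = e c *: v -> c != 0 ->
  2 * \sum_g `|'[act g v, v]| ^+ 2 <= #|G|%:R * '[v] ^+ 2.
Proof.
move=> zC zv c0; have m0 : 0 < m%:R :> C by rewrite ltr0Sn.
rewrite -(ler_pM2l m0).
have -> : m%:R * (2 * \sum_g `|'[act g v, v]| ^+ 2) =
  \sum_g \sum_(j < m) (`|'[act (y ^+ j)%g (act g v), v]| ^+ 2 +
                 `|'[act (y ^+ j)%g (act g v), act x v]| ^+ 2).
  rewrite exchange_big /= mulr_natl -[m in LHS]card_ord -sumr_const.
  apply: eq_bigr => j _; rewrite big_split /= mulr2n mulrDl mul1r; congr (_ + _).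
    rewrite (reindex_inj (mulgI (y ^+ j)%g)) /=.
    by apply: eq_bigr => g _; rewrite actM.
  rewrite (reindex_inj (mulgI (x^-1 * y ^+ j)%g)) /=.
  apply: eq_bigr => g _; rewrite -mulgA actM act_dotV invgK actM //.
rewrite mulrCA mulr_natl -sumr_const; apply: ler_sum => g _.
by apply: le_trans (sum_dot_expg_le _ zC zv c0) _; rewrite act_dot expr2.
Qed.

Lemma act_sub_dot g v : '[act g v - v] = 2 * ('[v] - 'Re '[act g v, v]).
Proof.
rewrite dnormB act_dot ReE mulrBr mulrCA divff ?pnatr_eq0 // mulr1; ring.
Qed.

(** The eigenspaces of a central z are orthogonal and stable under G, so squared displacements add
    up over them. *)
Lemma sum_act_sub_eproj (I : Type) (r : seq I) (f : I -> G) z v :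
  (forall g, commute z g) ->
  \sum_(i <- r) '[act (f i) v - v] =
    \sum_l \sum_(i <- r) '[act (f i) (eproj z l v) - eproj z l v].
Proof.
move=> zC; rewrite exchange_big /=; apply: eq_bigr => i _.
rewrite (dot_eproj z); apply: eq_bigr => l _.
by rewrite raddfB /= act_eprojC //; apply: commute_sym.
Qed.

End InnerProduct.

(** * Coordinates modulo the derived subgroup *)

Section Coordinates.
Variables (G : finGroupType) (q k : nat) (x : 'I_k -> G).
Hypothesis x_gen : <<[set x i | i : 'I_k]>>%g = [set: G]%SET.
Hypothesis expG : forall g : G, (g ^+ q.+2 = 1)%g.
Local Notation V := 'rV['I_q.+2]_k.
Local Notation D := [~: [set: G], [set: G]]%G.
Implicit Types (a b : V) (g h z : G).

(** This map is in general a homomorphism on V only modulo the derived subgroup [D]. *)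
Definition gword a : G := (\prod_i x i ^+ (a ord0 i : 'I_q.+2))%g.

Let nD g : g \in 'N(D)%g.
Proof. by apply: (fintype.subsetP (der_norm 1 [set: G]%G)); rewrite inE. Qed.

Let coD g h : coset D (g * h)%g = (coset D g * coset D h)%g.
Proof. by rewrite morphM. Qed.

Let coD_comm g h : commute (coset D g) (coset D h).
Proof.
rewrite /commute -!coD; apply/esym.
by rewrite (commgC g h) [in RHS]coD [X in _ = (_ * X)%g]coset_id ?mulg1 // mem_commg ?inE.
Qed.

Let eq_coset g h : coset D g = coset D h -> exists2 z, z \in D & g = (h * z)%g.
Proof.
move=> gh; exists (h^-1 * g)%g; last by rewrite mulKVg.
by apply: coset_idr => //; rewrite coD gh -coD mulVg morph1.
Qed.

Let coset_gwordD a b : coset D (gword (a + b)) = coset D (gword a * gword b)%g.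
Proof.
rewrite coD /gword; elim/big_rec3: _ => [|i u v t _ IH].
  by rewrite morph1 mulg1.
rewrite mxE (expg_ordD expG) !coD IH; set X := coset D (_ ^+ a _ _)%g.
set Y := coset D (_ ^+ b _ _)%g.
by rewrite -!mulgA; congr (_ * _)%g; rewrite !mulgA (coD_comm _ v).
Qed.

Lemma gwordD a b : exists2 z, z \in D & gword (a + b) = (gword a * gword b * z)%g.
Proof. exact/eq_coset/coset_gwordD. Qed.

Lemma gword0 : gword 0 = 1%g.
Proof. by rewrite /gword big1 // => i _; rewrite mxE expg0. Qed.

Lemma gword_gen i : gword (delta_mx 0 i) = x i.
Proof.
rewrite /gword (eq_bigr (fun j => if j == i then x j else 1%g)) => [|j _].
  by rewrite -big_mkcond big_pred1_eq.
by rewrite mxE eqxx; case: eqP => [->|_]; rewrite ?expg0 //; apply: expg1.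
Qed.

Lemma gwordP g : exists a, exists2 z, z \in D & g = (gword a * z)%g.
Proof.
suff : g \in [set g | [exists a, coset D g == coset D (gword a)]]%SET.
  by rewrite inE => /existsP[a /eqP/eq_coset]; exists a.
set S := [set g | _]%SET; suff gS : group_set S.
  have : [set: G]%SET \subset Group gS.
    rewrite -x_gen gen_subG; apply/fintype.subsetP => _ /imsetP[i _ ->].
    by rewrite inE; apply/existsP; exists (delta_mx 0 i); rewrite gword_gen.
  by move/fintype.subsetP; apply; rewrite inE.
apply/group_setP; split.
  by rewrite inE; apply/existsP; exists 0; rewrite gword0.
move=> g1 g2; rewrite !inE => /existsP[a /eqP ga] /existsP[b /eqP gb].
by apply/existsP; exists (a + b); rewrite coset_gwordD !coD ga gb.
Qed.

End Coordinates.

(** * Displacement in class-2 groups *)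

Section Displacement.
Variables (C : numClosedFieldType) (U : lmodType C) (form : {dot U for Num.conj}).
Local Notation "''[' u , v ]" := (form u%R v%R) : ring_scope.
Local Notation "''[' u ]" := '[u, u]%R : ring_scope.
Variables (G : finGroupType) (q k : nat) (act : G -> {linear U -> U}).
Hypothesis act1 : forall v, act 1%g v = v.
Hypothesis actM : forall (x y : G) v, act (x * y)%g v = act x (act y v).
Hypothesis act_dot : forall (x : G) u v, '[act x u, act x v] = '[u, v].
Hypothesis expG : forall g : G, (g ^+ q.+2 = 1)%g.
Variable x : 'I_k -> G.
Hypothesis x_gen : <<[set x i | i : 'I_k]>>%g = [set: G]%SET.
Hypothesis commG : forall g h z : G, commute [~ g, h]%g z.
Variable w : C.
Hypothesis w_prim : q.+2.-primitive_root w.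
Local Notation V := 'rV['I_q.+2]_k.
Local Notation D := [~: [set: G], [set: G]]%G.
Local Notation e := (echar w).
Implicit Types (a b : V) (g h z : G) (u v : U).

Let s : V -> G := gword x.

Lemma derived_commute z g : z \in D -> commute z g.
Proof.
move=> zD; have : z \in 'C([set: G])%g.
  apply: (fintype.subsetP _ _ zD); rewrite gen_subG.
  apply/fintype.subsetP => _ /imset2P[g1 g2 _ _ ->].
  by apply/centP => h _; apply: commG.
by move/centP => /(_ g (finset.in_setT _)).
Qed.

(** The condition is void for noncentral z; required for all z, it says that the centre acts on v by
    scalars. *)
Definition central_eigen v (z : G) : Prop :=
  (forall g, commute z g) -> exists c : 'I_q.+2, act z v = e c *: v.

Lemma act_gwordB a c v : (forall z, central_eigen v z) ->
  exists d : 'I_q.+2, act (s a) v = e d *: act (s c) (act (s (a - c)) v).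
Proof.
move=> cv; have [z zD zE] := gwordD x expG c (a - c).
have [d dv] := cv z (fun g => derived_commute g zD); exists d.
by rewrite -{1}(subrK c a) addrC [s _]zE actM dv linearZ actM.
Qed.

Lemma dot_gwordB a c v : (forall z, central_eigen v z) ->
  `|'[act (s a) v, act (s c) v]| = `|'[act (s (a - c)) v, v]|.
Proof.
move=> cv; have [d ->] := act_gwordB a c cv.
by rewrite dotZl normrM (norm_echar w_prim) mul1r act_dot.
Qed.

(* This is a coefficient of the tensor product of the action with its conjugate,
   on which the centre acts trivially. *)
Lemma fourier_sqr_ge0 v b : (forall z, central_eigen v z) ->
  0 <= fourier w (fun a => `|'[act (s a) v, v]| ^+ 2) b.
Proof.
move=> cv; have V0 : 0 < #|{: V}|%:R :> C by rewrite lt0r card_rV_neq0 ler0n.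
rewrite -(pmulr_rge0 _ V0) (fourier_autocorrelation w_prim).
pose y a := chi w b a *: act (s a) v; pose u a := act (s a) v.
have := schur_ge0 form u y; congr (0 <= _).
apply: eq_bigr => a _; apply: eq_bigr => c _.
rewrite -(dot_gwordB _ _ cv) normCK dotZl dotZr !rmorphM /= conjCK (chiN w_prim) /u; ring.
Qed.

(** As [D] fixes v, <s(a - c) v, v> = <s(a) v, s(c) v>, and the autocorrelation is the squared norm
    of one vector. *)
Lemma fourier_trivial_ge0 v b : (forall z, z \in D -> act z v = v) ->
  0 <= fourier w (fun a => '[act (s a) v, v]) b.
Proof.
move=> Dv; have V0 : 0 < #|{: V}|%:R :> C by rewrite lt0r card_rV_neq0 ler0n.
rewrite -(pmulr_rge0 _ V0) (fourier_autocorrelation w_prim).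
have -> : \sum_a \sum_c chi w b (- a) * chi w b c * '[act (s (a - c)) v, v] =
    '[\sum_a chi w b (- a) *: act (s a) v].
  rewrite linear_sumlz; apply: eq_bigr => a _ /=.
  rewrite linear_sumr; apply: eq_bigr => c _ /=.
  rewrite dotZl dotZr (chiN w_prim b c) conjCK.
  have [z zD zE] := gwordD x expG c (a - c).
  have -> : act (s a) v = act (s c) (act (s (a - c)) v).
    by rewrite -{1}(subrK c a) addrC [s _]zE actM Dv // actM.
  rewrite act_dot; ring.
exact: dnorm_ge0.
Qed.

Hypothesis act_inv : forall v, (forall g, act g v = v) -> v = 0.
Variable t : seq V.
Hypothesis spread : forall b, b != 0 ->
  'Re (\sum_(a <- t) chi w b a) <= (size t)%:R / 16.

Let t16 : 0 <= (size t)%:R / 16 :> C.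
Proof. by rewrite divr_ge0 ?ler0n. Qed.

Lemma sum_coef_trivial v : (forall z, z \in D -> act z v = v) ->
  'Re (\sum_(a <- t) '[act (s a) v, v]) <= (size t)%:R / 16 * '[v].
Proof.
move=> Dv.
have := positive_sum_le w_prim t16 (fun b => fourier_trivial_ge0 b Dv) spread.
rewrite [s 0](gword0 q x) act1; congr (_ <= _).
(* The sum of all s(a) v is G-invariant, since g = s(b) z with z in [D] permutes its terms; hence it
   is 0 and so is the mean. *)
suff -> : \sum_a '[act (s a) v, v] = 0 by rewrite mulr0 mul0r add0r.
rewrite -linear_sumlz /= (act_inv (v := \sum_a act (s a) v)) ?linear0l // => g.
have [b [z zD ->]] := gwordP x_gen expG g.
rewrite linear_sum [RHS](reindex_inj (addrI b)); apply: eq_bigr => a _ /=.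
have [z' z'D z'E] := gwordD x expG b a; rewrite [s (b + a)]z'E.
rewrite -actM -mulgA (derived_commute _ zD) mulgA !actM Dv //.
by rewrite [act z' v]Dv.
Qed.

(** The coefficient |<g v, v>|^2 depends only on g modulo [D]. Summing |<g s(a) v, v>|^2 over g and
    a in either order compares its means over V and over G. *)
Lemma sum_coef_sqr v : (forall z, central_eigen v z) ->
  #|G|%:R * \sum_a `|'[act (s a) v, v]| ^+ 2 =
  #|{: V}|%:R * \sum_g `|'[act g v, v]| ^+ 2.
Proof.
move=> cv.
have Dv z (h : G) : z \in D -> `|'[act (h * z)%g v, v]| = `|'[act h v, v]|.
  move=> zD; have [d dv] := cv z (fun g => derived_commute g zD).
  by rewrite actM dv linearZ dotZl normrM (norm_echar w_prim) mul1r.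
transitivity (\sum_g \sum_a `|'[act (g * s a)%g v, v]| ^+ 2).
  rewrite mulr_natl -sumr_const; apply: eq_bigr => g _.
  have [b [z zD ->]] := gwordP x_gen expG g.
  rewrite (reindex_inj (addrI b)); apply: eq_bigr => a _ /=.
  have [z' z'D z'E] := gwordD x expG b a; rewrite [s (b + a)]z'E.
  by rewrite -[(_ * z * _)%g]mulgA (derived_commute _ zD) mulgA (Dv z') ?(Dv z).
rewrite exchange_big mulr_natl -sumr_const; apply: eq_bigr => a _.
by rewrite [RHS](reindex_inj (mulIg (s a))).
Qed.

Lemma sum_coef_central v : (forall z, central_eigen v z) ->
  'Re (\sum_(a <- t) '[act (s a) v, v]) <= 3 / 4 * (size t)%:R * '[v].
Proof.
move=> cv; have [/forallP allc|] := boolP [forall g, [forall h, act [~ g, h]%g v == v]].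
  have Dv z : z \in D -> act z v = v.
    move=> zD; apply/eqP; have : z \in [set z | act z v == v]%SET.
      set S := [set z | _]%SET; suff gS : group_set S.
        apply: (fintype.subsetP (_ : D \subset Group gS) _ zD).
        rewrite gen_subG; apply/fintype.subsetP => _ /imset2P[g1 g2 _ _ ->].
        by rewrite inE; apply: (forallP (allc g1)).
      apply/group_setP; split; first by rewrite inE act1.
      move=> g h; rewrite !inE => /eqP gv /eqP hv.
      by rewrite actM hv gv.
    by rewrite inE.
  apply: le_trans (sum_coef_trivial Dv) _; apply: ler_wpM2r => //.
  rewrite mulrC; apply: ler_wpM2r; first exact: ler0n.
  by rewrite -subr_ge0 (_ : _ - _ = 11 / 16) ?divr_ge0 //; field.
(* In the remaining case some commutator moves v; being central, it acts on v by a nontrivial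
   scalar. *)
rewrite negb_forall => /existsP[y]; rewrite negb_forall => /existsP[g yg].
have [c cE] := cv [~ y, g]%g (commG y g).
have c0 : c != 0 by apply: contraNneq yg => c0; rewrite cE c0 echar0 scale1r.
have := sum_dot_sqr_le act1 actM act_dot expG w_prim (commG y g) cE c0.
set n : C := (size t)%:R => half.
have G0 : 0 < #|G|%:R :> C by rewrite ltr0n; apply/card_gt0P; exists 1%g.
have V0 : 0 < #|{: V}|%:R :> C by rewrite lt0r card_rV_neq0 ler0n.
have avg : (\sum_a `|'[act (s a) v, v]| ^+ 2) / #|{: V}|%:R <= '[v] ^+ 2 / 2.
  rewrite ler_pdivrMr // -(ler_pM2l G0) sum_coef_sqr //.
  have := ler_wpM2l (ltW V0) half; rewrite -subr_ge0 => h2.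
  rewrite -subr_ge0; have : 0 <= (2^-1 : C) by rewrite invr_ge0.
  by move=> /mulr_ge0 /(_ h2); congr (0 <= _); field.
have := positive_sum_le w_prim t16 (fun b => fourier_sqr_ge0 b cv) spread.
rewrite [s 0](gword0 q x) act1 -/n.
rewrite (ger0_norm (dnorm_ge0 _ _)) => FT.
(* Here 9/16 = 1/2 + 1/16: the mean, plus the deviation allowed by the spread of t. *)
have {}FT : \sum_(a <- t) `|'[act (s a) v, v]| ^+ 2 <= 9 / 16 * n * '[v] ^+ 2.
  move: FT; rewrite (Creal_ReP _ _) ?rpred_sum // => [|a _]; last first.
    by rewrite ger0_real // exprn_ge0.
  move=> /le_trans; apply; rewrite -mulrA.
  apply: le_trans (lerD (ler_wpM2l (ler0n C (size t)) avg) (lexx _)) _.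
  by rewrite -subr_ge0 (_ : _ - _ = 0) // /n; field.
have [v0|v0] := eqVneq v 0.
  rewrite v0 linear0r mulr0 big1 ?raddf0 // => a _; exact: linear0r.
have N0 : 0 < 3 / 2 * '[v] by rewrite mulr_gt0 ?divr_gt0 ?ltr0n // dnorm_gt0.
rewrite -(ler_pM2l N0) raddf_sum mulr_sumr /=.
(* The square (r - 3/4 |v|^2)^2 >= 0 bounds 3/2 |v|^2 r by r^2 + 9/16 |v|^4, passing from second
   moments to the real parts r. *)
apply: le_trans (_ : \sum_(a <- t) (`|'[act (s a) v, v]| ^+ 2 + 9 / 16 * '[v] ^+ 2) <= _).
  apply: ler_sum => a _; rewrite normC2_Re_Im; set r := 'Re _; set i := 'Im _.
  rewrite -subr_ge0.
  have -> : r ^+ 2 + i ^+ 2 + 9 / 16 * '[v] ^+ 2 - 3 / 2 * '[v] * r =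
      (r - 3 / 4 * '[v]) ^+ 2 + i ^+ 2.
    by move: r i ('[v]) => r i N; field.
  apply: addr_ge0; apply: real_exprn_even_ge0 => //; last exact: Creal_Im.
  by rewrite rpredB ?Creal_Re // ger0_real // mulr_ge0 ?divr_ge0.
rewrite big_split /= big_const_seq count_predT iter_addr_0 -mulr_natl -/n.
apply: le_trans (lerD FT (lexx _)) _.
by rewrite -subr_ge0 (_ : _ - _ = 0) //; field.
Qed.

Lemma displacement_ge v :
  (size t)%:R / 2 * '[v] <= \sum_(a <- t) '[act (s a) v - v].
Proof.
pose bound v := (size t)%:R / 2 * '[v] <= \sum_(a <- t) '[act (s a) v - v].
have base u : (forall z, central_eigen u z) -> bound u.
  move=> cu; rewrite /bound (eq_bigr _ (fun a _ => act_sub_dot act_dot (s a) u)).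
  rewrite -mulr_sumr sumrB -[X in _ * (_ - X)]raddf_sum /=.
  rewrite big_const_seq count_predT iter_addr_0 -mulr_natl.
  have h := sum_coef_central cu; rewrite -subr_ge0 in h.
  rewrite -subr_ge0; have : 0 <= (2 : C) by rewrite ler0n.
  by move=> /mulr_ge0 /(_ h); congr (0 <= _); field.
(* Central elements are diagonalised one at a time. Splitting along a central z preserves the
   scalars obtained for the other elements, because its projections commute with G. *)
have key (zs : seq G) : (forall u, (forall z, z \in zs -> central_eigen u z) -> bound u) ->
    forall u, bound u.
  elim: zs => [|z zs IHzs] H; first by move=> u; apply: H.
  apply: IHzs => u cu; have [zC|nzC] := pselect (forall g, commute z g); last first.
    by apply: H => z'; rewrite inE => /predU1P[->|/cu//] /nzC.
  rewrite /bound (sum_act_sub_eproj act1 actM act_dot expG w_prim t s _ zC).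
  rewrite (dot_eproj act1 actM act_dot expG w_prim z) mulr_sumr.
  apply: ler_sum => l _; apply: H => z'; rewrite inE => /predU1P[->|z'zs] z'C.
    by exists l; rewrite (act_eproj actM expG w_prim).
  have [c uc] := cu z' z'zs z'C; exists c.
  by rewrite (act_eprojC actM) // uc linearZ.
apply: (key (enum [set: G]%SET)) => u cu; apply: base => z.
by apply: cu; rewrite mem_enum inE.
Qed.

End Displacement.

(** * Spread families and average Kazhdan constants *)

Section SpreadFamily.
Variables (R : realType) (q k : nat) (w : R[i]).
Hypothesis w_prim : q.+2.-primitive_root w.
Local Notation V := 'rV['I_q.+2]_k.
Implicit Types (a b : V) (t : seq V).
Local Open Scope complex_scope.

Let r b a : R := complex.Re (chi w b a).

Let Re_sum t b : 'Re (\sum_(a <- t) chi w b a) = (\sum_(a <- t) r b a)%:C.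
Proof.
rewrite raddf_sum rmorph_sum; apply: eq_bigr => a _ /=.
by rewrite complexRe.
Qed.

Let norm_r b a : `|r b a| <= 1.
Proof.
by rewrite -lecR (le_trans (normc_ge_Re _)) // (norm_chi w_prim).
Qed.

Let sum_r b : b != 0 -> \sum_a r b a = 0.
Proof.
move=> b0; apply/eqP; rewrite -(fmorph_eq0 (real_complex R)) /= -Re_sum.
by rewrite (sum_chi w_prim) (negPf b0) mulr0 raddf0.
Qed.

(** Substitute for the exponential of l times the sum of [r b] over t. For b != 0 each factor has
    mean exactly 1 over a in V. *)
Let weight l b t : R := \prod_(a <- t) (1 + l * r b a).

(* The average over [a] of the total weight of [a :: t] is the total weight of
   [t], so a greedy choice of [a] never increases it. *)
Lemma greedy_weight l n : exists2 t, size t = n &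
  \sum_(b | b != 0) weight l b t <= #|{: V}|%:R.
Proof.
elim: n => [|n [t tn tV]].
  exists [::] => //; rewrite /weight; under eq_bigr do rewrite big_nil.
  by rewrite sumr_const ler_nat max_card.
suff [a le_a] : exists a,
    \sum_(b | b != 0) weight l b (a :: t) <= \sum_(b | b != 0) weight l b t.
  by exists (a :: t); rewrite /= ?tn // (le_trans le_a).
apply: contrapT => /forallNP lt_t.
have : \sum_(a : V) \sum_(b | b != 0) weight l b t <
       \sum_(a : V) \sum_(b | b != 0) weight l b (a :: t).
  apply: ltr_sum => [|a _]; last by rewrite ltNge; apply/negP/lt_t.
  by apply/hasP; exists 0; rewrite ?mem_index_enum.
suff -> : \sum_(a : V) \sum_(b | b != 0) weight l b (a :: t) =
    \sum_(a : V) \sum_(b | b != 0) weight l b t by rewrite ltxx.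
rewrite exchange_big [RHS]exchange_big /=; apply: eq_bigr => b b0.
under eq_bigr do rewrite /weight big_cons mulrDl mul1r -mulrA [r _ _ * _]mulrC mulrA.
by rewrite big_split /= -mulr_sumr sum_r // mulr0 addr0.
Qed.

(** With z = y - 2 l^2 one has exp z <= 1 / (1 - z), and (1 + y)(1 - z) = 1 - y^2 + 2 l^2 (1 + y) >=
    1. *)
Let expR_le_1D (y l : R) : `|y| <= l -> l <= 2^-1 -> expR (y - 2 * l ^+ 2) <= 1 + y.
Proof.
rewrite ler_norml => /andP[y1 y2] l2.
have z0 : 0 < 1 - (y - 2 * l ^+ 2) by nra.
have := expR_ge1Dx (- (y - 2 * l ^+ 2)); rewrite expRN => h.
rewrite -[expR _]invrK invf_ple ?posrE ?invr_gt0 ?expR_gt0 //; last by nra.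
apply: le_trans h; rewrite -div1r ler_pdivrMr; nra.
Qed.

Lemma spread_exists n : (2048 * q.+2 * k <= n)%N ->
  exists2 t : seq V, size t = n &
    forall b, b != 0 -> 'Re (\sum_(a <- t) chi w b a) <= (size t)%:R / 16.
Proof.
(* With l = 1/64 the potential bounds the sums by n / 32 + 64 * k * ln m. *)
move=> kn; have [t tn tV] := greedy_weight 64^-1 n; exists t => // b b0.
have l0 : 0 < 64^-1 :> R by rewrite invr_gt0 ltr0n.
have lr a : `|64^-1 * r b a| <= 64^-1.
  by rewrite normrM gtr0_norm // ler_piMr // ltW.
have W_ge0 c : 0 <= weight 64^-1 c t.
  apply: prodr_ge0 => a _; have := norm_r c a; rewrite ler_norml => /andP[].
  lra.
have {}tV : weight 64^-1 b t <= #|{: V}|%:R.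
  by apply: le_trans tV; rewrite (bigD1 b) //= lerDl sumr_ge0.
have : expR (\sum_(a <- t) (64^-1 * r b a - 2 * 64^-1 ^+ 2)) <= #|{: V}|%:R.
  apply: le_trans tV; rewrite expR_sum; apply: ler_prod => a _.
  rewrite expR_ge0 /=; apply: expR_le_1D => //; lra.
have V0 : 0 < #|{: V}|%:R :> R by rewrite ltr0n; apply/card_gt0P; exists 0.
rewrite -[X in _ <= X]lnK // ler_expR card_mx card_ord mul1n natrX lnXn ?ltr0n //.
(* From ln m < m and n >= 2048 m k, the term 64 k ln m is at most n / 32. *)
have := ln_sublinear (ltr0Sn R q.+1).
rewrite sumrB -mulr_sumr big_const_seq count_predT iter_addr_0 tn Re_sum.
have -> : n%:R / 16 = (n%:R / 16 : R)%:C by rewrite rmorphM fmorphV !rmorph_nat.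
rewrite lecR; set S := \sum_(a <- t) r b a.
rewrite -[ln _ *+ k]mulr_natr -[_ *+ n]mulr_natr.
have := ler0n R k; move: kn; rewrite -(ler_nat R) !natrM.
set L := ln _; nra.
Qed.

End SpreadFamily.

Section AverageKazhdan.
Variable R : realType.
Local Open Scope complex_scope.

Lemma hdot_hnorm (H : hilbertSpace R) (v : H) : hdot H v v = (hnorm v ^+ 2)%:C.
Proof. by rewrite hdotE /hnorm rmorphXn /= RRe_real // normr_real. Qed.

Lemma average_kazhdan_class2 (G : finGroupType) (q k : nat) (x : 'I_k -> G) :
  (0 < k)%N -> <<[set x i | i : 'I_k]>>%g = [set: G]%SET ->
  (forall g h z : G, commute [~ g, h]%g z) ->
  (forall g : G, (g ^+ q.+2 = 1)%g) ->
  exists T : seq G, [/\ generates T, (size T = (2048 * q.+2).+1 * k)%N &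
    is_avg_kazhdan_constant T (4^-1 : R)].
Proof.
move=> k0 x_gen commG expG.
have [w w_prim] := prim_root_exists R[i] (ltn0Sn q.+1).
pose n := (2048 * q.+2 * k)%N.
have [t tn spread] := spread_exists (k := k) w_prim (leqnn n).
exists (codom x ++ map (gword x) t); split.
- apply/eqP; rewrite finset.eqEsubset finset.subsetT -x_gen gen_subG.
  apply/fintype.subsetP => _ /imsetP[i _ ->]; apply: mem_gen.
  by rewrite inE mem_cat codom_f.
- by rewrite size_cat size_map size_codom card_ord tn mulSn.
split; first by rewrite invr_gt0 ltr0n.
apply: le_ereal_inf_tmp => _ [rho rho_inv ->].
apply: le_ereal_inf_tmp => _ [v /= v0 <-]; rewrite lee_fin.
have N0 : 0 < hnorm v ^+ 2.
  by rewrite -(ltcR) -hdot_hnorm dnorm_gt0.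
have := displacement_ge (@urep1 _ _ rho) (@urepM _ _ rho) (@urep_dot _ _ rho)
  expG x_gen commG w_prim rho_inv spread v.
rewrite hdot_hnorm; under eq_bigr do rewrite hdot_hnorm.
have -> : (size t)%:R / 2 = ((size t)%:R / 2 : R)%:C.
  by rewrite rmorphM fmorphV !rmorph_nat.
rewrite -rmorphM -rmorph_sum lecR => le_t.
rewrite /avg_displacement -mulr_suml big_cat /= big_map.
rewrite size_cat size_map size_codom card_ord.
rewrite ler_pdivlMl ?ltr0n ?addn_gt0 ?k0 // ler_pdivlMr //.
(* The generators have nonnegative displacement, and the words make up at least half of T, so the
   bound 1/2 over t becomes 1/4 over T. *)
have kn : (k <= size t)%N by rewrite tn /n leq_pmull.
set S := \sum_(i <- codom x) _.
have S0 : 0 <= S by apply: sumr_ge0 => i _; apply: sqr_ge0.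
move: le_t kn; rewrite -(ler_nat R) natrD; set Q := \sum_(_ <- _) _.
nra.
Qed.

End AverageKazhdan.

(** * The groups Gamma_{k,2} *)

Section Morphisms.
Variables (G G' : groupType) (F : G -> G').
Hypothesis FM : {morph F : g h / (g * h)%g}.

Lemma gmorph1 : F 1%g = 1%g.
Proof. by apply: (mulgI (F 1%g)); rewrite -FM !mulg1. Qed.

Lemma gmorphV g : F g^-1%g = (F g)^-1%g.
Proof. by apply: (mulIg (F g)); rewrite -FM !mulVg gmorph1. Qed.

Lemma gmorphX g n : F (g ^+ n)%g = (F g ^+ n)%g.
Proof. by elim: n => [|n IHn]; rewrite ?expg0 ?gmorph1 // !expgS FM IHn. Qed.

Lemma gmorphR g h : F [~ g, h]%g = [~ F g, F h]%g.
Proof. by rewrite /commg /conjg !FM !gmorphV. Qed.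
End Morphisms.

Section GammaClass2.
Variables (p : nat) (p_prime : prime p) (k : nat).
Local Notation G := (Gamma p_prime k 2).

Definition gamma_proj (g : freeGroup k) : G := quo_proj (lps_ns (freeGroup k) p 3) g.

Definition gamma_gen (i : 'I_k) : G := gamma_proj (free_gen i).

Lemma gamma_projM : {morph gamma_proj : g h / (g * h)%g}.
Proof. exact: quo_projM. Qed.

Lemma gamma_projP (y : G) : exists g, y = gamma_proj g.
Proof. by elim/quotW: y => g; exists g. Qed.

Lemma gamma_proj_lps3 g : lps (freeGroup k) p 3 g -> gamma_proj g = 1%g.
Proof. exact: (quo_proj_eq1 (N := lps_ns (freeGroup k) p 3)). Qed.

Lemma gamma_gen_generates : <<[set gamma_gen i | i : 'I_k]>>%g = [set: G]%SET.
Proof.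
apply/eqP; rewrite finset.eqEsubset finset.subsetT; apply/fintype.subsetP => y _.
have [g ->] := gamma_projP y; elim/free_ind: g => [|[i b] g IHg].
  by rewrite (gmorph1 gamma_projM) group1.
rewrite gamma_projM groupM //.
have Gi : gamma_gen i \in <<[set gamma_gen i | i : 'I_k]>>%g.
  by apply: mem_gen; apply/imsetP; exists i.
by case: b; rewrite /free_letter /= ?(gmorphV gamma_projM) ?groupV.
Qed.

Lemma gamma_class2 (g h z : G) : commute [~ g, h]%g z.
Proof.
have [g' ->] := gamma_projP g; have [h' ->] := gamma_projP h.
have [z' ->] := gamma_projP z.
apply/commgP; rewrite -(gmorphR gamma_projM g' h') -(gmorphR gamma_projM _ z').
apply/eqP/gamma_proj_lps3.
by apply: lps_stepR; apply: lps_stepR.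
Qed.

Lemma gamma_exp (g : G) : (g ^+ (p ^ 2) = 1)%g.
Proof.
have [g' ->] := gamma_projP g; rewrite -(gmorphX gamma_projM); apply: gamma_proj_lps3.
by rewrite expnS expn1 expgM; apply: lps_stepX; apply: lps_stepX.
Qed.

End GammaClass2.

(** * Heisenberg groups over F_p as targets of homomorphisms *)

Definition heis (p : nat) : Type := ('F_p * 'F_p * 'F_p)%type.
HB.instance Definition _ p := Choice.on (heis p).

Section Heisenberg.
Variable p : nat.
Local Notation H := (heis p).

Definition heis_one : H := (0, 0, 0).
(** Product of upper unitriangular 3 x 3 matrices: the first two coordinates lie above the diagonal,
    the third in the corner. *)
Definition heis_mul (u v : H) : H :=
  (u.1.1 + v.1.1, u.1.2 + v.1.2, u.2 + v.2 + u.1.1 * v.1.2).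
Definition heis_inv (u : H) : H := (- u.1.1, - u.1.2, u.1.1 * u.1.2 - u.2).

Lemma heis_mulA : associative heis_mul.
Proof. by move=> u v w; congr (_, _, _) => /=; ring. Qed.
Lemma heis_mul1 : left_id heis_one heis_mul.
Proof. by case=> -[a b] c; congr (_, _, _) => /=; ring. Qed.
Lemma heis_1mul : right_id heis_one heis_mul.
Proof. by case=> -[a b] c; congr (_, _, _) => /=; ring. Qed.
Lemma heis_mulV : left_inverse heis_one heis_inv heis_mul.
Proof. by case=> -[a b] c; congr (_, _, _) => /=; ring. Qed.
Lemma heis_Vmul : right_inverse heis_one heis_inv heis_mul.
Proof. by case=> -[a b] c; congr (_, _, _) => /=; ring. Qed.

HB.instance Definition _ := isGroup.Build H
  heis_mulA heis_mul1 heis_1mul heis_mulV heis_Vmul.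

Definition heisX : H := (1, 0, 0).
Definition heisY : H := (0, 1, 0).
Definition heisZ : H := (0, 0, 1).

Lemma heis_commE (u v : H) :
  [~ u, v]%g = (0, 0, u.1.1 * v.1.2 - u.1.2 * v.1.1).
Proof.
rewrite /commg /conjg.
rewrite -[LHS]/(heis_mul (heis_inv u) (heis_mul (heis_inv v) (heis_mul u v))).
by congr (_, _, _) => /=; ring.
Qed.

Hypothesis p_prime : prime p.

Lemma mulrn_Fp (a : 'F_p) : a *+ p = 0.
Proof. by rewrite -mulr_natr (pcharf0 (pchar_Fp p_prime)) mulr0. Qed.

(** The corner need not vanish when p = 2, so p-th powers are only shown to be central. *)
Lemma heis_expp (u : H) : exists c, (u ^+ p)%g = (0, 0, c).
Proof.
suff E n : exists c, (u ^+ n)%g = (u.1.1 *+ n, u.1.2 *+ n, c).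
  by have [c ->] := E p; exists c; rewrite !mulrn_Fp.
elim: n => [|n [c IHn]]; first by exists 0.
by rewrite expgS IHn !mulrS; eexists.
Qed.

Lemma heis_center_expp (c : 'F_p) : (((0, 0, c) : H) ^+ p = 1)%g.
Proof.
suff E n : (((0, 0, c) : H) ^+ n)%g = (0, 0, c *+ n) by rewrite E mulrn_Fp.
elim: n => [|n IHn] //; rewrite expgS IHn.
by congr (_, _, _) => /=; rewrite ?mulrS; ring.
Qed.

End Heisenberg.

Lemma lps_step_sub (G : groupType) p (H K : set G) : is_subgroup K ->
  (forall h, H h -> K (h ^+ p)%g) -> (forall h g, H h -> K [~ h, g]%g) ->
  (lps_step p H `<=` K)%classic.
Proof.
move=> sK KX KR _ [g Hg [h Hh <-]]; apply: subgroupM => //.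
  by apply: (gen_min sK _ Hg) => _ [u Hu <-]; apply: KX.
by apply: (gen_min sK _ Hh) => _ [u Hu [v _ <-]]; apply: KR.
Qed.

(** The second term of the series is sent into the subgroup of elements (0, 0, c), which is central
    of exponent p, so the third is sent to 1. *)
Lemma heis_lps3 (G : groupType) p (p_prime : prime p) (F : G -> heis p) :
  {morph F : g h / (g * h)%g} -> forall g, lps G p 3 g -> F g = 1%g.
Proof.
move=> FM.
have sub2 : (lps_step p (lps G p 1) `<=` [set g | exists c, F g = (0, 0, c)])%classic.
  apply: lps_step_sub => [|h _|h g _] /=.
  - split=> /=; first by exists 0; rewrite (gmorph1 FM).
    move=> g h [c gc] [d hd]; rewrite FM (gmorphV FM) gc hd; eexists.
    by congr (_, _, _) => /=; rewrite ?oppr0 ?addr0.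
  - by rewrite (gmorphX FM); apply: heis_expp.
  by rewrite (gmorphR FM) heis_commE; eexists.
suff : (lps_step p (lps G p 2) `<=` [set g | F g = 1%g])%classic by [].
apply: lps_step_sub => [|h /sub2[c hc]|h g /sub2[c hc]] /=.
- split=> /=; first exact: gmorph1.
  by move=> g h gc hd; rewrite FM (gmorphV FM) gc hd mulgV.
- by rewrite (gmorphX FM) hc heis_center_expp.
by rewrite (gmorphR FM) heis_commE hc /=; congr (_, _, _); ring.
Qed.

(** * Quadratic growth of log |Gamma| *)

Section Cardinality.
Variables (p : nat) (p_prime : prime p) (k : nat).
Local Notation G := (Gamma p_prime k 2).

Lemma gamma_proj_eq (F : freeGroup k -> heis p) g h :
  {morph F : g h / (g * h)%g} -> gamma_proj p_prime g = gamma_proj p_prime h ->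
  F g = F h.
Proof.
move=> FM /(quo_eqP (lps_ns (freeGroup k) p 3)) /= gh.
have := heis_lps3 p_prime FM gh; rewrite FM (gmorphV FM) => h1.
by rewrite -[RHS](mulKVg (F g)) h1 mulg1.
Qed.

Lemma gamma_card_gt1 : (0 < k)%N -> (1 < #|{: G}|)%N.
Proof.
move=> k0; pose i0 := Ordinal k0.
have [F [[FM FE] _]] := free_universal (fun _ : 'I_k => heisX p).
rewrite (cardD1 1%g) (cardD1 (gamma_gen p_prime i0)) !inE.
case: eqP => //= F1.
have : F (free_gen i0) = F 1%g.
  by apply: gamma_proj_eq FM _; rewrite (gmorph1 (@gamma_projM p p_prime k)).
rewrite FE (gmorph1 FM) => /(congr1 (fun u : heis p => u.1.1)) /= /eqP.
by rewrite oner_eq0.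
Qed.

(* The products of commutators [~ x_(alpha i), x_(beta j)] over the subsets of
   I * I are separated by the homomorphisms to the Heisenberg group sending one
   x_(alpha i) to X, one x_(beta j) to Y and all other generators to 1. *)
Lemma gamma_card_ge (I : finType) (alpha beta : I -> 'I_k) :
  injective alpha -> injective beta -> (forall i j, alpha i != beta j) ->
  (2 ^ (#|I| ^ 2) <= #|{: G}|)%N.
Proof.
move=> injA injB AB.
pose com (ij : I * I) : freeGroup k := [~ free_gen (alpha ij.1), free_gen (beta ij.2)]%g.
pose el (A : {set I * I}) := (\prod_(ij in A) com ij)%g.
have injE : injective (fun A => gamma_proj p_prime (el A)).
  move=> A B AB'; apply/setP => ij.
  pose f l : heis p := if l == alpha ij.1 then heisX p else
                       if l == beta ij.2 then heisY p else 1%g.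
  have [F [[FM FE] _]] := free_universal f.
  have FelE (D : {set I * I}) :
      F (el D) = if ij \in D then heisZ p else 1%g.
    rewrite /el (big_morph F FM (gmorph1 FM)).
    rewrite (eq_bigr (fun ij' => if ij' == ij then heisZ p else 1%g)).
      rewrite -big_mkcondr /=; case: ifP => ijD.
        rewrite (big_pred1 ij) // => ij' /=; case: eqP => [->|]; rewrite ?ijD ?andbF //.
      by rewrite big_pred0 // => ij'; case: eqP => [->|]; rewrite ?ijD ?andbF.
    move=> [i j] _; rewrite (gmorphR FM) !FE /f heis_commE /=.
    rewrite (inj_eq injA) (inj_eq injB) [beta j == _]eq_sym !(negPf (AB _ _)).
    case: ij {f F FM FE} => i0 j0 /=; rewrite -pair_eqE /=.
    by case: (i == i0); case: (j == j0) => /=; congr (_, _, _); ring.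
  have := gamma_proj_eq FM AB'; rewrite !FelE.
  case: (ij \in A); case: (ij \in B) => // /(congr1 (fun u : heis p => u.2)) h;
    by case/eqP: (oner_neq0 'F_p).
have := leq_card _ injE; rewrite -cardsT -powersetT card_powerset cardsT card_prod.
by rewrite -mulnn.
Qed.

(** For k >= 2 and h = floor(k/2), the first h generators are paired with the next h. Then k <= 3 h
    gives the exponent 9. For k = 1 a nontrivial group suffices. *)
Lemma gamma_card_sqr : (0 < k)%N -> (2 ^ (k ^ 2) <= #|{: G}| ^ 9)%N.
Proof.
move=> k0; have [k1|k1] := leqP k 1.
  have -> : (k ^ 2 = 1)%N by rewrite (eqP (_ : k == 1%N)) // eqn_leq k1.
  apply: leq_trans (_ : 2 ^ 9 <= _)%N => //.
  by rewrite leq_exp2r //; apply: gamma_card_gt1.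
pose h := k./2.
have hk : (h <= k)%N by rewrite /h; lia.
have hk' (j : 'I_h) : (h + j < k)%N by have := ltn_ord j; rewrite /h; lia.
have := @gamma_card_ge 'I_h (widen_ord hk) (fun j => Ordinal (hk' j)).
rewrite card_ord => le_h; apply: leq_trans (_ : (2 ^ (h ^ 2)) ^ 9 <= _)%N.
  rewrite -expnM leq_exp2l //.
  have : (k <= 3 * h)%N by rewrite /h; lia.
  by nia.
rewrite leq_exp2r //; apply: le_h.
- by move=> i j /(congr1 val) /= ij; apply: val_inj.
- by move=> i j /(congr1 val) /= /addnI ij; apply: val_inj.
by move=> i j; rewrite -val_eqE /= neq_ltn (leq_trans (ltn_ord i)) ?leq_addr.
Qed.

End Cardinality.

Theorem corollary1p9 (R : realType) (p : nat) (p_prime : prime p) (eps : R) :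
  0 < eps -> eps < 1 / 4 ->
  exists C : R, forall k : nat, (1 <= k)%N ->
    (g_eps (Gamma p_prime k 2) eps
       <= (C * Num.sqrt (ln #|{: Gamma p_prime k 2}|%:R))%:E)%E.
Proof.
move=> eps0 eps4; have [q pq] : exists q, (p ^ 2 = q.+2)%N.
  exists (p ^ 2 - 2)%N; have := prime_gt1 p_prime; nia.
pose M := (2048 * q.+2).+1.
(* The multiset T has M k elements, and k^2 ln 2 <= 9 ln |Gamma| gives k <= 3 sqrt(ln |Gamma|) /
   sqrt(ln 2). *)
exists (M%:R * 3 / Num.sqrt (ln 2)) => k k1.
have expG (g : Gamma p_prime k 2) : (g ^+ q.+2 = 1)%g by rewrite -pq gamma_exp.
have [T [genT sizeT kazT]] := average_kazhdan_class2 R k1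
  (gamma_gen_generates p_prime k) (@gamma_class2 p p_prime k) expG.
apply: ge_ereal_inf; exists (M * k)%:R%:E.
  exists (M * k)%N => //; exists T; split; rewrite ?sizeT //.
  by exists 4^-1 => //; move: eps4; rewrite div1r => /ltW.
rewrite lee_fin natrM -!mulrA ler_wpM2l ?ler0n //.
have ln2 : 0 < ln 2 :> R by rewrite ln_gt0 // ltr1n.
have G0 : 0 < #|{: Gamma p_prime k 2}|%:R :> R.
  by rewrite ltr0n; apply/card_gt0P; exists 1%g.
rewrite mulrCA ler_pdivlMl ?sqrtr_gt0 // mulrC.
have := gamma_card_sqr p_prime k1.
rewrite -(ler_nat R) !natrX -ler_ln ?posrE ?exprn_gt0 // !lnXn //.
move=> /ler_wsqrtr; rewrite -[ln 2 *+ _]mulr_natl -[ln _ *+ 9]mulr_natl.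
rewrite -[9%N]/(3 ^ 2)%N !natrX.
by rewrite !(sqrtrM _ (sqr_ge0 _)) !sqrtr_sqr !normr_nat.
Qed.
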